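(* Let $(\{(X_\sigma, d_\sigma)\}_{\sigma \in \Sigma}, \{\alpha_{\sigma}^{\tau} \colon X_\sigma \to X_\tau\}_{\sigma \leqslant \tau})$ be a direct system, indexed by an upward directed set $\Sigma$, in the category $\mathsf{cmn}$ of compact metric spaces and non-expansive mappings, and assume that $\alpha_\sigma^\tau$ is surjective for all $\sigma \leqslant \tau$. Then this system has an inductive limit in $\mathsf{cmn}$. Furthermore, (1) the object of the inductive limit does not depend, up to isometry, on the choice of surjective arrows for the system: if $(\{(X_\sigma, d_\sigma)\}_{\sigma \in \Sigma}, \{\beta_{\sigma}^{\tau}\}_{\sigma \leqslant \tau})$ is another direct system in $\mathsf{cmn}$ over the same $\Sigma$ with the same objects and with all arrows surjective, then the objects of the inductive limits of the two systems are isometric; (2) the arrows of the inductive limit are surjective.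
   Context: A mapping $f\colon (X,d)\to(Y,\varrho)$ is non-expansive if $\varrho(f(x),f(y))\leqslant d(x,y)$ for all $x,y\in X$. $\mathsf{cmn}$ is the category of all compact metric spaces with non-expansive mappings as arrows. A direct system in a category $\mathsf A$ indexed by an upward directed set $\Sigma$ is a family of objects $\{A_\sigma\}_{\sigma\in\Sigma}$ with morphisms $\{\alpha_\sigma^\tau\colon A_\sigma\to A_\tau\}_{\sigma\leqslant\tau}$ such that $\alpha_\sigma^\sigma=\mathrm{id}_{A_\sigma}$ and $\alpha_\varrho^\tau\circ\alpha_\sigma^\varrho=\alpha_\sigma^\tau$ for $\sigma\leqslant\varrho\leqslant\tau$. Its inductive limit is an object $A$ of $\mathsf A$ with morphisms $\{\alpha_\sigma\colon A_\sigma\to A\}_{\sigma\in\Sigma}$ such that $\alpha_\tau\circ\alpha_\sigma^\tau=\alpha_\sigma$ for $\sigma\leqslant\tau$, and such that for every object $A'$ and morphisms $\{\xi_\sigma\colon A_\sigma\to A'\}_{\sigma\in\Sigma}$ with $\xi_\tau\circ\alpha_\sigma^\tau=\xi_\sigma$ for $\sigma\leqslant\tau$ there is a unique morphism $\nu\colon A\to A'$ with $\nu\circ\alpha_\sigma=\xi_\sigma$ for all $\sigma\in\Sigma$. *)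

(* Defs.v *)
From HB Require Import structures.
From mathcomp Require Import all_boot all_order all_algebra.
From mathcomp Require Import all_classical all_reals all_analysis.

Set Implicit Arguments.
Unset Strict Implicit.
Unset Printing Implicit Defensive.

Import Order.TTheory GRing.Theory Num.Theory.

Local Open Scope classical_set_scope.
Local Open Scope ring_scope.

(* The empty space is an object: [metricType] does not require a point. *)
Record cmn (R : realType) := Cmn {
  cmn_sort :> metricType R;
  cmn_compact : compact [set: cmn_sort] }.

Definition nonexpansive (R : realType) (X Y : metricType R) (f : X -> Y) :=
  forall x y, mdist (f x) (f y) <= mdist x y.

Definition isometric (R : realType) (X Y : metricType R) :=
  exists f : X -> Y,
    bijective f /\ forall x y, mdist (f x) (f y) = mdist x y.

Definition upward_directed (disp : Order.disp_t) (S : preorderType disp) :=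
  inhabited S /\ forall s t : S, exists u : S, (s <= u)%O /\ (t <= u)%O.

(* The arrows carry a proof of [s <= t]; this order is boolean, so such proofs
   are unique and an arrow depends only on its two indices. *)
Record direct_system (R : realType) (disp : Order.disp_t)
    (S : preorderType disp) (X : S -> cmn R)
    (alpha : forall s t : S, (s <= t)%O -> X s -> X t) : Prop := DirectSystem {
  ds_nonexpansive : forall (s t : S) (st : (s <= t)%O),
    nonexpansive (alpha s t st);
  ds_id : forall (s : S) (ss : (s <= s)%O), alpha s s ss =1 id;
  ds_comp : forall (s r t : S) (sr : (s <= r)%O) (rt : (r <= t)%O)
      (st : (s <= t)%O),
    alpha r t rt \o alpha s r sr =1 alpha s t st }.

Definition cocone (R : realType) (disp : Order.disp_t)
    (S : preorderType disp) (X : S -> cmn R)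
    (alpha : forall s t : S, (s <= t)%O -> X s -> X t)
    (A : cmn R) (a : forall s : S, X s -> A) :=
  (forall s : S, nonexpansive (a s)) /\
  (forall (s t : S) (st : (s <= t)%O), a t \o alpha s t st =1 a s).

Definition inductive_limit (R : realType) (disp : Order.disp_t)
    (S : preorderType disp) (X : S -> cmn R)
    (alpha : forall s t : S, (s <= t)%O -> X s -> X t)
    (A : cmn R) (a : forall s : S, X s -> A) :=
  cocone alpha a /\
  forall (A' : cmn R) (xi : forall s : S, X s -> A'), cocone alpha xi ->
    exists! nu : A -> A',
      nonexpansive nu /\ forall s : S, nu \o a s =1 xi s.

(* Main.v *)
Require Import Defs.
From HB Require Import structures.
From mathcomp Require Import all_boot all_order all_algebra.
From mathcomp Require Import all_classical all_reals all_analysis.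
From mathcomp Require Import lra.

Set Implicit Arguments.
Unset Strict Implicit.
Unset Printing Implicit Defensive.

Import Order.TTheory GRing.Theory Num.Theory.

Local Open Scope classical_set_scope.
Local Open Scope ring_scope.

(** Because every arrow is surjective, a limit can be built as a quotient of any
single object [X s0]: put on it the pseudometric
[rho x y = inf_(t >= s0) d_t (alpha x) (alpha y)] and identify points at
distance zero.  A point of another [X s] is sent into the quotient by matching
it with a point of [X s0] that has the same image in some later object
([exists_inf_metric_cocone]).

What makes a surjective cocone a limit is that distances in its apex are the
infima of the distances along the system, the property [inf_metric] below: maps
of a competing cocone are non-expansive at every stage, hence for the infimum,
so they factor through the apex ([inf_metric_universal]).  As limits are unique
up to isomorphism, every limit has surjective legs and infimal distances
([inductive_limit_surj_inf_metric]).

For the independence of the arrows, the distances [d_t] pulled back to [X s]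
decrease to the continuous limit distance on the compact space [X s * X s], so
by Dini's argument they do so uniformly ([inf_metric_uniform]): for [t] large,
the leg [b t : X t -> B] of a limit of the second system shrinks no distance by
more than [e].  The leg [a t : X t -> A] of a limit of the first system does not
enlarge distances, so [b t] composed with a section of [a t] is a map [A -> B]
shrinking distances by at most [e].  A pointwise limit of such maps along an
ultrafilter is a map [A -> B] that shrinks no distance
([almost_expanding_limit]).  By symmetry there is such a map [B -> A], and two
compact metric spaces with expanding maps both ways are isometric
([expanding_both_ways]). *)

(** * Expanding maps of compact metric spaces *)

Lemma nonexpansive_continuous (R : realType) (X Y : metricType R) (f : X -> Y) :
  nonexpansive f -> continuous f.
Proof.
move=> f1 x; apply/metricType_numDomainType.cvgrPdist_lt => e e0.
near=> y; apply: (le_lt_trans (f1 x y)); near: y.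
exact: (@metricType_numDomainType.cvgr_dist_lt _ _ _ (nbhs x) _ id).
Unshelve. all: by end_near. Qed.

Lemma nbhs_mdist_lt (R : realType) (X : metricType R) (x : X) (e : R) :
  0 < e -> \forall y \near x, mdist x y < e.
Proof.
move=> e0; exact: (@metricType_numDomainType.cvgr_dist_lt _ _ _ (nbhs x) _ id).
Qed.

(** The sequence of pairs has a cluster point, near which it returns infinitely
often; the same two indices serve for both sequences. *)
Lemma recurrent_pair (R : realType) (X : metricType R)
    (u v : nat -> X) (e : R) :
  compact [set: X] -> 0 < e ->
  exists n k, mdist (u n) (u (n + k.+1)%N) < e /\
              mdist (v n) (v (n + k.+1)%N) < e.
Proof.
move=> cX e0; have e20 : 0 < e / 2 by rewrite divr_gt0.
have [|[p q] [_ cl]] := compact_setX cX cX (F := (fun n => (u n, v n)) @ \oo).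
  by apply: filterS filterT.
have close N : exists2 n, (N <= n)%N &
    mdist p (u n) < e / 2 /\ mdist q (v n) < e / 2.
  have [|| z [[n /= Nn <-] [/= pu qv]]] := cl
    ((fun n => (u n, v n)) @` [set n | (N <= n)%N])
    [set z | mdist p z.1 < e / 2 /\ mdist q z.2 < e / 2].
  - by exists N => // n /= Nn; exists n.
  - exists ([set y | mdist p y < e / 2], [set y | mdist q y < e / 2]) => //=.
    by split; exact: nbhs_mdist_lt.
  by exists n.
have [n _ [pn qn]] := close 0%N.
have [m nm [pm qm]] := close n.+1.
exists n, (m - n.+1)%N; rewrite addnS -addSn subnKC//; split.
- have := metric_triangle (u n) p (u m); rewrite (metric_sym (u n) p); lra.
- have := metric_triangle (v n) q (v m); rewrite (metric_sym (v n) q); lra.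
Qed.

Definition expanding (R : realType) (X Y : metricType R) (f : X -> Y) :=
  forall x y, mdist x y <= mdist (f x) (f y).

Lemma expanding_iter (R : realType) (X : metricType R) (f : X -> X) n x y :
  expanding f -> mdist x y <= mdist (iter n f x) (iter n f y).
Proof.
move=> fe; elim: n => //= n IHn; exact: le_trans IHn (fe _ _).
Qed.

(** Since [f] is expanding, two iterates that are close force their starting
points to have been at least as close, so recurrence of the orbit becomes return
to the starting point. *)
Lemma expanding_returns (R : realType) (X : metricType R) (f : X -> X)
    x y (e : R) : compact [set: X] -> expanding f -> 0 < e ->
  exists k, mdist x (iter k.+1 f x) < e /\ mdist y (iter k.+1 f y) < e.
Proof.
move=> cX fe e0.
have [n [k [xk yk]]] :=
  recurrent_pair (fun n => iter n f x) (fun n => iter n f y) cX e0.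
exists k; split.
- by apply: le_lt_trans xk; rewrite iterD; exact: expanding_iter.
- by apply: le_lt_trans yk; rewrite iterD; exact: expanding_iter.
Qed.

(** After some [k.+1] steps both points are back near their origin; distances
only grew along the way, so the first step cannot have enlarged theirs. *)
Lemma expanding_endo_isometry (R : realType) (X : metricType R) (f : X -> X) :
  compact [set: X] -> expanding f ->
  forall x y, mdist (f x) (f y) = mdist x y.
Proof.
move=> cX fe x y; apply/eqP; rewrite eq_le fe andbT.
apply/ler_addgt0Pr => e e0; have e20 : 0 < e / 2 by rewrite divr_gt0.
have [k [xk yk]] := expanding_returns x y cX fe e20.
have := expanding_iter k (f x) (f y) fe; rewrite -!iterSr.
have := metric_triangle (iter k.+1 f x) x (iter k.+1 f y).
have := metric_triangle x y (iter k.+1 f y).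
rewrite (metric_sym _ x); lra.
Qed.

(** The range is compact, hence closed, and [y] is a limit of its own forward
orbit. *)
Lemma expanding_endo_surj (R : realType) (X : metricType R) (f : X -> X) :
  compact [set: X] -> expanding f -> forall y, exists x, f x = y.
Proof.
move=> cX fe y.
have fc : continuous f.
  apply: nonexpansive_continuous => a b.
  by rewrite expanding_endo_isometry.
have : closed (range f).
  apply: compact_closed; first exact: metric_hausdorff.
  by apply: continuous_compact => //; exact: continuous_subspaceT.
have : closure (range f) y.
  move=> B; rewrite -metricType_numDomainType.filter_from_mdist_nbhs.
  move=> [e /= e0 Be].
  have [k [yk _]] := expanding_returns y y cX fe e0.
  by exists (iter k.+1 f y); split; [exists (iter k f y)|exact: Be].
by move=> /[swap] clf /clf[x _ <-]; exists x.
Qed.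

(** Both composites are isometries onto, and the distance of [f x] and [f y] is
squeezed between that of [x], [y] and that of their images under [g \o f]. *)
Lemma expanding_both_ways (R : realType) (A B : metricType R)
    (f : A -> B) (g : B -> A) :
  compact [set: A] -> compact [set: B] ->
  expanding f -> expanding g -> isometric A B.
Proof.
move=> cA cB fe ge; exists f.
have gfe : expanding (g \o f) by move=> x y; exact: le_trans (fe _ _) (ge _ _).
have fge : expanding (f \o g) by move=> x y; exact: le_trans (ge _ _) (fe _ _).
have iso x y : mdist (f x) (f y) = mdist x y.
  apply/eqP; rewrite eq_le fe andbT.
  by rewrite -(expanding_endo_isometry cA gfe x y); exact: ge.
split=> //; rewrite -setTT_bijective; split => //.
- move=> x y _ _ fxy; apply: mdist_positivity.
  by rewrite -iso fxy mdistxx.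
- move=> y _; have [x <-] := expanding_endo_surj cB fge y.
  by exists (g x).
Qed.

Lemma fmap_ultra (T U : Type) (f : T -> U) (G : set_system T) :
  UltraFilter G -> UltraFilter (f @ G).
Proof.
move=> GU; split=> [|H HF GH]; first exact: fmap_proper_filter.
apply/seteqP; split=> [A HA|]; last exact: GH.
have [//|nA] := in_ultra_setVsetC (f @^-1` A) GU.
have /filter_ex[z [Az nAz]] : H (A `&` ~` A) by apply: filterI => //; exact: GH.
by [].
Qed.

(** An ultrafilter on the indices, finer than the cofinite one, makes the values
of the approximating maps converge at all points of [X] at once, although [X]
may be uncountable. *)
Lemma almost_expanding_limit (R : realType) (X Y : metricType R) :
  compact [set: Y] ->
  (forall e : R, 0 < e -> exists f : X -> Y,
     forall x y, mdist x y <= mdist (f x) (f y) + e) ->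
  exists f : X -> Y, expanding f.
Proof.
move=> cY approx.
have near_f : forall n : nat, exists f : X -> Y,
    forall x y, mdist x y <= mdist (f x) (f y) + n.+1%:R^-1.
  by move=> n; apply: approx; rewrite invr_gt0.
have [f fP] := boolp.choice near_f.
have [G [GU ooG]] := ultraFilterLemma (eventually_filter : ProperFilter \oo).
have lim_f : forall x : X, exists y : Y, f n x @[n --> G] --> y.
  move=> x; move: (cY); rewrite compact_ultra => /(_ (f n x @[n --> G])).
  by move=> /(_ (fmap_ultra _ GU) filterT)[y [_ fy]]; exists y.
have [F FP] := boolp.choice lim_f.
exists F => x y; apply/ler_addgt0Pr => e e0.
have e30 : 0 < e / 3 by rewrite divr_gt0.
have /filter_ex[n [[Fx Fy] en]] : G [set n |
    (mdist (F x) (f n x) < e / 3 /\ mdist (F y) (f n y) < e / 3) /\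
    n.+1%:R^-1 < e / 3].
  apply: filterI; first apply: filterI.
  - exact: (metricType_numDomainType.cvgr_dist_lt (FP x)).
  - exact: (metricType_numDomainType.cvgr_dist_lt (FP y)).
  - apply: ooG; exact: near_infty_natSinv_lt (PosNum e30).
move: (n.+1%:R^-1) en (fP n x y) => r re.
have := metric_triangle (f n x) (F x) (f n y).
have := metric_triangle (F x) (F y) (f n y).
rewrite (metric_sym (f n x) (F x)); lra.
Qed.

(** * Metric quotient of a pseudometric *)

(** The quotient is realised as the subtype of canonically chosen
representatives of the classes, on which [rho] separates points. *)
Lemma metric_quotient (R : realType) (T : choiceType) (rho : T -> T -> R) :
  (forall x, rho x x = 0) -> (forall x y, rho x y = rho y x) ->
  (forall y x z, rho x z <= rho x y + rho y z) ->
  exists (M : metricType R) (q : T -> M),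
    (forall p, exists x, q x = p) /\
    forall x y, mdist (q x) (q y) = rho x y.
Proof.
move=> rhoxx rhoC rhoD.
have rho_ge0 x y : 0 <= rho x y.
  by have := rhoD y x x; rewrite rhoxx (rhoC y); lra.
have rho0l x y z : rho x y = 0 -> rho x z = rho y z.
  move=> xy0; apply/eqP; rewrite eq_le.
  by have := rhoD y x z; have := rhoD x y z; rewrite (rhoC y x) xy0; lra.
pose rep x := choose (fun y => rho x y == 0) x.
have repP x : rho x (rep x) = 0.
  by apply/eqP/(chooseP (P := fun y => rho x y == 0)); rewrite rhoxx.
have rep_eq x y : rho x y = 0 -> rep x = rep y.
  move=> xy0; rewrite /rep; transitivity (choose (fun z => rho y z == 0) x).
    by apply: eq_choose => z; rewrite (rho0l _ _ z xy0).
  by apply: choose_id; rewrite ?rhoxx // rhoC xy0.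
have repK x : rep (rep x) == rep x.
  by apply/eqP; apply: rep_eq; rewrite rhoC repP.
pose S := {x : T | rep x == x}.
pose dS (x y : S) := rho (sval x) (sval y).
have dS0 (x y : S) : dS x y = 0 -> x = y.
  case: x y => [x xP] [y yP]; rewrite /dS /= => xy0; apply: val_inj => /=.
  by rewrite -(eqP xP) -(eqP yP); exact: rep_eq.
pose mS := isMetric.Build R S (fun x => rhoxx (sval x)) dS0
  (fun x y => rhoC (sval x) (sval y))
  (fun y x z => rhoD (sval y) (sval x) (sval z)).
pose M : metricType R := HB.pack S mS.
exists M, (fun x => exist _ (rep x) (repK x) : S); split.
  by case=> x xP; exists x; apply: val_inj; exact/eqP.
move=> x y; transitivity (rho (rep x) (rep y)) => //.
by rewrite -(rho0l _ _ _ (repP x)) rhoC -(rho0l _ _ _ (repP y)) rhoC.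
Qed.

(** * Limits of directed systems with surjective arrows *)

(** By monotonicity along the system the distances in the apex of a cocone are
lower bounds; this asserts that they are the infima. *)
Definition inf_metric (R : realType) (disp : Order.disp_t)
    (S : preorderType disp) (X : S -> cmn R)
    (alpha : forall s t : S, (s <= t)%O -> X s -> X t)
    (A : cmn R) (a : forall s : S, X s -> A) :=
  forall (s : S) (x y : X s) (e : R), 0 < e -> exists t (st : (s <= t)%O),
    mdist (alpha s t st x) (alpha s t st y) < mdist (a s x) (a s y) + e.

Section DirectSystem.
Context (R : realType) (disp : Order.disp_t) (S : preorderType disp).
Context (X : S -> cmn R) (alpha : forall s t : S, (s <= t)%O -> X s -> X t).
Hypothesis S_directed : upward_directed S.
Hypothesis alpha_system : direct_system alpha.
Hypothesis alpha_surj : forall (s t : S) (st : (s <= t)%O),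
  set_surj [set: X s] [set: X t] (alpha st).

Lemma arrow_mdist s r t (sr : (s <= r)%O) (rt : (r <= t)%O) (st : (s <= t)%O)
    x y :
  mdist (alpha st x) (alpha st y) <= mdist (alpha sr x) (alpha sr y).
Proof.
rewrite -!(ds_comp alpha_system sr rt st) /=.
exact: (ds_nonexpansive alpha_system).
Qed.

Lemma upper_bound (s t : S) : exists u, (s <= u)%O /\ (t <= u)%O.
Proof. by case: S_directed => _; apply. Qed.

Lemma leg_mdist (A : cmn R) (a : forall s, X s -> A) s t (st : (s <= t)%O) x y :
  cocone alpha a -> mdist (a s x) (a s y) <= mdist (alpha st x) (alpha st y).
Proof.
by move=> [a1 aC]; rewrite -!(aC s t st) /=; exact: a1.
Qed.

(** A point of the apex that comes from [s0] comes from every later object, and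
therefore from any object preceding that one by surjectivity of the arrow. *)
Lemma legs_surj (A : cmn R) (a : forall s, X s -> A) s0 :
  cocone alpha a -> set_surj [set: X s0] [set: A] (a s0) ->
  forall s, set_surj [set: X s] [set: A] (a s).
Proof.
move=> [_ aC] a0 s p _; have [x _ <-] := a0 p I.
have [u [s0u su]] := upper_bound s0 s.
have [y _ xy] := alpha_surj su (I : setT (alpha s0u x)).
by exists y => //; rewrite -(aC s u su) -(aC s0 u s0u) /= xy.
Qed.

(** The mediating map is a leg of the competing cocone after a section of the
corresponding leg of [a]; the bound [xi_le], obtained by passing to the infimum,
makes it both independent of the section and non-expansive. *)
Lemma inf_metric_universal (A : cmn R) (a : forall s, X s -> A) :
  cocone alpha a -> (forall s, set_surj [set: X s] [set: A] (a s)) ->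
  inf_metric alpha a -> inductive_limit alpha a.
Proof.
move=> aC asurj ainf; split=> // B xi xiC.
have xi_le s x y : mdist (xi s x) (xi s y) <= mdist (a s x) (a s y).
  apply/ler_addgt0Pr => e e0; have [t [st xy]] := ainf s x y e e0.
  exact: le_trans (leg_mdist _ _ _ xiC) (ltW xy).
have [[s0] _] := S_directed.
have section p : exists x, a s0 x = p.
  by have [x _ <-] := asurj s0 p I; exists x.
have [g gK] := boolp.choice section.
have xi_factor s x : xi s0 (g (a s x)) = xi s x.
  have [u [s0u su]] := upper_bound s0 s.
  rewrite -(xiC.2 s0 u s0u) -(xiC.2 s u su) /=.
  apply: mdist_positivity; apply/eqP; rewrite eq_le mdist_ge0 andbT.
  apply: le_trans (xi_le _ _ _) _.
  have := aC.2 s0 u s0u (g (a s x)); have := aC.2 s u su x.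
  by rewrite /= gK => -> ->; rewrite mdistxx.
exists (fun p => xi s0 (g p)); split.
  split=> [p q|s x]; last exact: xi_factor.
  by apply: le_trans (xi_le _ _ _) _; rewrite !gK.
move=> nu [_ nuP]; apply/funext => p.
by rewrite -(nuP s0) /= gK.
Qed.

(** The comparison map [nu] to the limit with apex [L] is invertible because
[mu \o nu] and the identity both mediate from [a] to itself; being
non-expansive, [nu] keeps the distances in [A] above those in [L]. *)
Lemma inf_metric_transfer (L A : cmn R) (l : forall s, X s -> L)
    (a : forall s, X s -> A) :
  cocone alpha l -> (forall s, set_surj [set: X s] [set: L] (l s)) ->
  inf_metric alpha l -> inductive_limit alpha a ->
  (forall s, set_surj [set: X s] [set: A] (a s)) /\ inf_metric alpha a.
Proof.
move=> lC lsurj linf [aC auniv].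
have [_ luniv] := inf_metric_universal lC lsurj linf.
have [nu [[nu1 nua] _]] := auniv L l lC.
have [mu [[mu1 mul] _]] := luniv A a aC.
have munu : mu \o nu = id.
  have [w [_ w_uniq]] := auniv A a aC.
  have <- : w = id by apply: w_uniq; split=> // x y; exact: lexx.
  symmetry; apply: w_uniq; split.
  - by move=> x y; exact: le_trans (mu1 _ _) (nu1 _ _).
  - by move=> s x; have /= -> := nua s x; exact: mul.
split=> [s p _|s x y e e0].
- have [x _ lx] := lsurj s (nu p) I; exists x => //.
  by rewrite -(mul s x) /= lx -[LHS]/((mu \o nu) p) munu.
- have [t [st xy]] := linf s x y e e0; exists t, st.
  apply: lt_le_trans xy _; rewrite lerD2r -!(nua s) /=; exact: nu1.
Qed.

(** Dini's argument, with the covering property of compactness applied to the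
filter of tails of the directed index. *)
Lemma inf_metric_uniform (A : cmn R) (a : forall s, X s -> A) s (e : R) :
  cocone alpha a -> inf_metric alpha a -> 0 < e ->
  exists t (st : (s <= t)%O), forall x y : X s,
    mdist (alpha st x) (alpha st y) < mdist (a s x) (a s y) + e.
Proof.
move=> aC ainf e0; have e60 : 0 < e / 6 by rewrite divr_gt0.
pose F := filter_from [set: S] (fun t => [set u | (t <= u)%O]).
have FF : Filter F.
  apply: filter_from_filter; first by exists s.
  move=> t u _ _; have [v [tv uv]] := upper_bound t u; exists v => // w /= vw.
  by split; [exact: le_trans tv vw|exact: le_trans uv vw].
have /compact_near_coveringP cov :=
  compact_setX (@cmn_compact _ (X s)) (@cmn_compact _ (X s)).
have [|t _ tP] := cov S F (fun t (z : X s * X s) => forall st : (s <= t)%O,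
    mdist (alpha st z.1) (alpha st z.2) < mdist (a s z.1) (a s z.2) + e).
  (* Moving both points by e / 6 costs 2 e / 6 at stage u and 2 e / 6 in A, on
     top of the e / 6 lost at (x, y) itself. *)
  move=> [x y] _; have [t [st xy]] := ainf s x y (e / 6) e60.
  exists ([set z : X s * X s | mdist x z.1 < e / 6 /\ mdist y z.2 < e / 6],
     [set u | (t <= u)%O]).
    split; last by exists t.
    exists ([set z | mdist x z < e / 6], [set z | mdist y z < e / 6]) => //=.
    by split; exact: nbhs_mdist_lt.
  move=> [[x' y'] u] [[/= xx' yy'] tu] su.
  have := ds_nonexpansive alpha_system su x x'.
  have := ds_nonexpansive alpha_system su y y'.
  have := arrow_mdist st tu su x y.
  have := aC.1 s x x'; have := aC.1 s y y'.
  have := metric_triangle (alpha su x') (alpha su x) (alpha su y').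
  have := metric_triangle (alpha su x) (alpha su y) (alpha su y').
  have := metric_triangle (a s x) (a s x') (a s y).
  have := metric_triangle (a s x') (a s y') (a s y).
  rewrite (metric_sym (a s y') (a s y)) (metric_sym (alpha su x') (alpha su x)).
  lra.
have [u [su tu]] := upper_bound s t; exists u, su => x y.
exact: (tP u tu (x, y) _).
Qed.

(** [rho] is the infimum of the distances at the stages after [s0]; the two
bounds determine it, and later arguments go through them alone. *)
Lemma infimum_distance s0 : exists rho : X s0 -> X s0 -> R,
  (forall t (st : (s0 <= t)%O) x y,
     rho x y <= mdist (alpha st x) (alpha st y)) /\
  (forall x y e, 0 < e -> exists t (st : (s0 <= t)%O),
     mdist (alpha st x) (alpha st y) < rho x y + e).
Proof.
pose D x y := [set r : R | exists t (st : (s0 <= t)%O),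
  mdist (alpha st x) (alpha st y) = r].
have D0 x y : lbound (D x y) 0 by move=> _ [t [st <-]]; exact: mdist_ge0.
exists (fun x y => inf (D x y)); split.
  move=> t st x y; apply: ge_inf; first by exists 0.
  by exists t, st.
move=> x y e e0; have [|_ [t [st <-]] lt] := @inf_adherent _ (D x y) _ e0.
  split; last by exists 0.
  by exists (mdist (alpha (lexx s0) x) (alpha (lexx s0) y)), s0, (lexx s0).
by exists t, st.
Qed.

(** A leg sends [x] to the class of any [y : X s0] that agrees with [x] at some
later stage; [link_rho] shows at one stroke that this class is well defined and
that the leg is non-expansive. *)
Lemma exists_inf_metric_cocone : exists (L : cmn R) (l : forall s, X s -> L),
  [/\ cocone alpha l, forall s, set_surj [set: X s] [set: L] (l s)
    & inf_metric alpha l].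
Proof.
have [[s0] _] := S_directed.
have [rho [rho_le rho_lt]] := infimum_distance s0.
have rho_ge0 x y : 0 <= rho x y.
  apply/ler_addgt0Pr => e e0; have [t [st xy]] := rho_lt x y e e0.
  exact: le_trans (mdist_ge0 _ _) (ltW xy).
have rho_mdist x y : rho x y <= mdist x y.
  apply: le_trans (rho_le s0 (lexx s0) x y) _.
  exact: (ds_nonexpansive alpha_system).
have [|||M [q [q_surj qE]]] := @metric_quotient R (X s0) rho.
- move=> x; apply/eqP; rewrite eq_le rho_ge0 andbT.
  by rewrite -(mdistxx x).
- suff rhoC x y : rho x y <= rho y x.
    by move=> x y; apply/eqP; rewrite eq_le !rhoC.
  apply/ler_addgt0Pr => e e0; have [t [st yx]] := rho_lt y x e e0.
  by apply: le_trans (rho_le t st x y) _; rewrite metric_sym; exact: ltW.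
- move=> y x z; apply/ler_addgt0Pr => e e0.
  have e20 : 0 < e / 2 by rewrite divr_gt0.
  have [t [st xy]] := rho_lt x y (e / 2) e20.
  have [u [su yz]] := rho_lt y z (e / 2) e20.
  have [v [tv uv]] := upper_bound t u.
  have sv := le_trans st tv.
  have := rho_le v sv x z.
  have := metric_triangle (alpha sv x) (alpha sv y) (alpha sv z).
  have := arrow_mdist st tv sv x y; have := arrow_mdist su uv sv y z.
  lra.
have cM : compact [set: M].
  have -> : [set: M] = range q.
    by apply/seteqP; split=> // p _; have [x <-] := q_surj p; exists x.
  apply: continuous_compact; last exact: cmn_compact.
  apply: continuous_subspaceT; apply: nonexpansive_continuous => x y.
  by rewrite qE.
pose link s (x : X s) (y : X s0) := exists u (su : (s <= u)%O)
  (s0u : (s0 <= u)%O), alpha su x = alpha s0u y.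
have link_up s x y : link s x y -> exists u, forall v (uv : (u <= v)%O)
    (sv : (s <= v)%O) (s0v : (s0 <= v)%O), alpha sv x = alpha s0v y.
  move=> [u [su [s0u xy]]]; exists u => v uv sv s0v.
  have := ds_comp alpha_system su uv sv x.
  by have := ds_comp alpha_system s0u uv s0v y; rewrite /= xy => -> ->.
have link_rho s x x' y y' : link s x y -> link s x' y' ->
    rho y y' <= mdist x x'.
  move=> /link_up[u uP] /link_up[u' uP'].
  have [w [uw u'w]] := upper_bound u u'.
  have [w' [sw' s0w']] := upper_bound s s0.
  have [v [wv w'v]] := upper_bound w w'.
  have sv := le_trans sw' w'v; have s0v := le_trans s0w' w'v.
  apply: le_trans (rho_le v s0v y y') _.
  rewrite -(uP v (le_trans uw wv) sv s0v) -(uP' v (le_trans u'w wv) sv s0v).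
  exact: (ds_nonexpansive alpha_system).
have link_total s x : exists y, link s x y.
  have [u [su s0u]] := upper_bound s s0.
  have [y _ xy] := alpha_surj s0u (I : setT (alpha su x)).
  by exists y, u, su, s0u.
pose h s x := projT1 (cid (link_total s x)).
have hP s x : link s x (h s x) by exact: projT2 (cid (link_total s x)).
pose l s x := q (h s x).
have link_q s x y : link s x y -> l s x = q y.
  move=> xy; apply: mdist_positivity; rewrite qE.
  apply/eqP; rewrite eq_le rho_ge0 andbT -(mdistxx x).
  exact: link_rho (hP s x) xy.
have lC : @cocone _ _ _ _ alpha (Cmn cM) l.
  split=> [s x y|s t st x]; first by rewrite qE; exact: link_rho.
  rewrite /= -[RHS]/(l s x); symmetry; apply: link_q.
  have [u [tu [s0u xy]]] := hP t (alpha st x).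
  exists u, (le_trans st tu), s0u; rewrite -xy.
  by rewrite -(ds_comp alpha_system st tu).
exists (Cmn cM), l; split=> //.
- apply: (legs_surj (s0 := s0)) => // p _; have [y <-] := q_surj p.
  by exists y => //; apply: link_q; exists s0, (lexx s0), (lexx s0).
- move=> s x y e e0; rewrite qE.
  have [t [s0t xy]] := rho_lt (h s x) (h s y) e e0.
  have [u uP] := link_up _ _ _ (hP s x).
  have [u' uP'] := link_up _ _ _ (hP s y).
  have [w [uw u'w]] := upper_bound u u'.
  have [w' [sw' tw']] := upper_bound s t.
  have [v [wv w'v]] := upper_bound w w'.
  have sv := le_trans sw' w'v; have tv := le_trans tw' w'v.
  have s0v := le_trans s0t tv.
  exists v, sv; apply: le_lt_trans xy.
  rewrite (uP v (le_trans uw wv) sv s0v) (uP' v (le_trans u'w wv) sv s0v).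
  exact: arrow_mdist.
Qed.

(** Both properties hold for the limit constructed above and pass to any other
limit along the comparison map. *)
Lemma inductive_limit_surj_inf_metric (A : cmn R) (a : forall s, X s -> A) :
  inductive_limit alpha a ->
  (forall s, set_surj [set: X s] [set: A] (a s)) /\ inf_metric alpha a.
Proof.
have [L [l [lC lsurj linf]]] := exists_inf_metric_cocone.
exact: inf_metric_transfer lC lsurj linf.
Qed.

End DirectSystem.

(** The points of [A] and of [B] are lifted to the same object [X t], where the
two systems share their metric: the leg to [A] is non-expansive and the leg to
[B] loses at most [e].  Lifting through [beta] is what brings the uniform
estimate, stated over [X s], to all of [X t]. *)
Lemma almost_expanding_between_limits (R : realType) (disp : Order.disp_t)
    (S : preorderType disp) (X : S -> cmn R)
    (alpha beta : forall s t : S, (s <= t)%O -> X s -> X t)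
    (A : cmn R) (a : forall s : S, X s -> A)
    (B : cmn R) (b : forall s : S, X s -> B) (e : R) :
  upward_directed S -> direct_system beta ->
  (forall (s t : S) (st : (s <= t)%O),
    set_surj [set: X s] [set: X t] (beta s t st)) ->
  cocone alpha a -> (forall s, set_surj [set: X s] [set: A] (a s)) ->
  cocone beta b -> inf_metric beta b -> 0 < e ->
  exists f : A -> B, forall p q, mdist p q <= mdist (f p) (f q) + e.
Proof.
move=> dirS beta_sys beta_surj aC a_surj bC binf e0.
have [[s] _] := dirS.
have [t [st tP]] := inf_metric_uniform dirS beta_sys s bC binf e0.
have section p : exists x, a t (beta s t st x) = p.
  have [y _ <-] := a_surj t p I; have [x _ <-] := beta_surj s t st y I.
  by exists x.
have [g gK] := boolp.choice section.
exists (fun p => b s (g p)) => p q.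
rewrite -{1}(gK p) -{1}(gK q).
exact: le_trans (aC.1 _ _ _) (ltW (tP _ _)).
Qed.

Theorem theorem2p3 (R : realType) (disp : Order.disp_t)
    (Sigma : preorderType disp) (X : Sigma -> cmn R)
    (alpha : forall s t : Sigma, (s <= t)%O -> X s -> X t)
    (Sigma_directed : upward_directed Sigma)
    (alpha_system : direct_system alpha)
    (alpha_surj : forall (s t : Sigma) (st : (s <= t)%O),
      set_surj [set: X s]%classic [set: X t]%classic (alpha s t st)) :
  [/\ exists (A : cmn R) (a : forall s : Sigma, X s -> A),
        inductive_limit alpha a,
      forall beta : forall s t : Sigma, (s <= t)%O -> X s -> X t,
        direct_system beta ->
        (forall (s t : Sigma) (st : (s <= t)%O),
          set_surj [set: X s]%classic [set: X t]%classic (beta s t st)) ->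
        forall (A : cmn R) (a : forall s : Sigma, X s -> A)
               (B : cmn R) (b : forall s : Sigma, X s -> B),
          inductive_limit alpha a -> inductive_limit beta b ->
          isometric A B
    & forall (A : cmn R) (a : forall s : Sigma, X s -> A),
        inductive_limit alpha a ->
        forall s : Sigma, set_surj [set: X s]%classic [set: A]%classic (a s)].
Proof.
have props beta :=
  @inductive_limit_surj_inf_metric R disp Sigma X beta Sigma_directed.
split.
- have [L [l [lC lsurj linf]]] :=
    exists_inf_metric_cocone Sigma_directed alpha_system alpha_surj.
  by exists L, l; exact: inf_metric_universal.
- move=> beta beta_system beta_surj A a B b limA limB.
  have [a_surj a_inf] := props _ alpha_system alpha_surj A a limA.
  have [b_surj b_inf] := props _ beta_system beta_surj B b limB.
  have cA := @cmn_compact _ A; have cB := @cmn_compact _ B.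
  have [f fe] : exists f : A -> B, expanding f.
    apply: almost_expanding_limit => // e e0.
    exact: almost_expanding_between_limits limA.1 a_surj limB.1 b_inf e0.
  have [g ge] : exists g : B -> A, expanding g.
    apply: almost_expanding_limit => // e e0.
    exact: almost_expanding_between_limits limB.1 b_surj limA.1 a_inf e0.
  exact: expanding_both_ways fe ge.
- by move=> A a limA; have [] := props _ alpha_system alpha_surj A a limA.
Qed.
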